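(* Let $n$ and $m$ be positive integers with $2n \le m \le \frac{1}{4}n^{3/2}$. Let $\mathcal{G}_m$ be the family of graphs with at most $m$ edges. Then $$\sqrt[3]{\tfrac{1}{2}m-n} \;\le\; d(n, \mathcal{G}_m) \;\le\; 16 \sqrt[3]{m},$$ where $d(n,\mathcal{G}_m)$ is the maximum diameter of a path-pairable graph on $n$ vertices belonging to $\mathcal{G}_m$.
   Context: All graphs are finite, simple and undirected. For a positive integer $k$, a graph $G$ on at least $2k$ vertices is $k$-path-pairable if for any pair of disjoint sets of distinct vertices $\{x_1,\dots,x_k\}$ and $\{y_1,\dots,y_k\}$ of $G$ there exist $k$ pairwise edge-disjoint paths $P_1,\dots,P_k$ in $G$ such that $P_i$ is a path from $x_i$ to $y_i$ for each $1\le i\le k$. A $k$-path-pairable graph on $2k$ or $2k+1$ vertices is called path-pairable. For a graph $G$, $d(G)$ denotes its diameter. For a family of graphs $\mathcal{G}$, $$d(n,\mathcal{G}) = \max\{d(G) : G\in\mathcal{G} \text{ and } G \text{ is path-pairable on } n \text{ vertices}\}.$$ *)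

(* Defs.v *)
(* MathComp / MathComp-Analysis *)
From HB Require Import structures.
From mathcomp Require Import all_boot all_order all_algebra.
From mathcomp Require Import boolp reals exp.

Set Implicit Arguments.
Unset Strict Implicit.
Unset Printing Implicit Defensive.

(* A finite simple graph on T is given by its set of edges, each edge being
   an unordered pair of distinct vertices. *)
Record sgraph (T : finType) := SGraph {
  edges :> {set {set T}};
  _ : [forall e in edges, #|e| == 2]
}.

HB.instance Definition _ (T : finType) := [isSub for @edges T].
HB.instance Definition _ (T : finType) := [Finite of sgraph T by <:].

Definition adj (T : finType) (G : sgraph T) : rel T :=
  [rel x y | [set x; y] \in edges G].

(* The path visits x :: p, in this order; its length is size p. *)
Definition is_path (T : finType) (G : sgraph T) (x y : T) (p : seq T) : bool :=
  [&& path (adj G) x p, last x p == y & uniq (x :: p)].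

Definition path_edges (T : finType) (x : T) (p : seq T) : seq {set T} :=
  [seq [set u.1; u.2] | u <- zip (x :: p) p].

Definition edge_disjoint (T : finType) (x : T) (p : seq T) (y : T) (q : seq T) :
  bool := ~~ has (mem (path_edges x p)) (path_edges y q).

Definition k_path_pairable (k : nat) (T : finType) (G : sgraph T) : Prop :=
  2 * k <= #|T| /\
  forall x y : 'I_k -> T,
    injective x -> injective y -> (forall i j, x i <> y j) ->
    exists P : 'I_k -> seq T,
      (forall i, is_path G (x i) (y i) (P i)) /\
      (forall i j, i <> j -> edge_disjoint (x i) (P i) (x j) (P j)).

Definition path_pairable (T : finType) (G : sgraph T) : Prop :=
  exists k : nat,
    [/\ 0 < k, #|T| = 2 * k \/ #|T| = (2 * k).+1 & k_path_pairable k G].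

(* Least length of a path from x to y. A path has length < #|T|, so the value
   is #|T| exactly when no path exists; #|T| then stands for infinity. This
   case does not arise in path-pairable graphs, which are connected. *)
Definition dist (T : finType) (G : sgraph T) (x y : T) : nat :=
  find (fun l => [exists p : l.-tuple T, is_path G x y p]) (iota 0 #|T|).

Definition diameter (T : finType) (G : sgraph T) : nat :=
  \max_(x : T) \max_(y : T) dist G x y.

Definition graph_family := forall T : finType, pred (sgraph T).

(* d(n, F). Every graph on n vertices is isomorphic to one on 'I_n, so for an
   isomorphism-invariant family F the vertex set may be taken to be 'I_n. *)
Definition max_diameter (n : nat) (F : graph_family) : nat :=
  \max_(G : sgraph 'I_n | F _ G && `[< path_pairable G >]) diameter G.

Definition at_most_edges (m : nat) : graph_family :=
  fun T G => #|edges G| <= m.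

(* Main.v *)
From HB Require Import structures.
Require Import Defs.
From mathcomp Require Import all_boot all_order all_algebra.
From mathcomp Require Import boolp reals exp.
From mathcomp Require Import zify ring lra.

Set Implicit Arguments.
Unset Strict Implicit.
Unset Printing Implicit Defensive.

(** Upper bound.  Let [a_i] be the number of vertices at distance [i] from an
    end of a diametral pair, [S_i] the number at distance at most [i], and [e_i]
    the number of edges between distances [i] and [i + 1].  As many terminal
    pairs as the smaller side allows can be placed across the cut after layer
    [i], and their edge-disjoint paths use different edges of that cut, so
    [min (S_i, n - S_i) <= e_i <= a_i * a_(i+1)] ([cut_condition]).  While
    [S_i <= n / 2] this gives [S_(i+1) - S_(i-1) = a_i + a_(i+1) >= 2 sqrt S_i],
    so [S_i] grows quadratically ([square_growth]) and the sum of the [e_i]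
    cubically ([cube_growth]).  Counting layers from whichever end has half of
    them before the median vertex ([layers_bound]) yields
    [diameter ^ 3 <= 384 * m].

    Lower bound.  Let [p = r + 1].  The graph [funnel r q] has a chain of [p]
    layers of [p] vertices, consecutive layers completely joined; a further
    layer of [p ^ 2] ports, each joined to one vertex of the final chain layer
    and to all of three hubs; and [q] leaves, each joined to two of the hubs.
    The hubs form a triangle.  It has [2 n + p ^ 3 - p ^ 2 - 3] edges, and the
    first chain layer is at distance [p + 2] from every leaf.

    To link an arbitrary pairing, every chain vertex [(i, j)] travels to its own
    port by moving, at each layer, by the fixed step [i] modulo [p]: at layer
    [l] it stands at [j + i (l - i)], so the edge it takes determines the step,
    hence [i], hence [j], and no edge is used twice.  From there, and from the
    other vertices directly, the two ends of each pair meet at a common hub.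
    Edges to the hubs are disputed only by a port and the chain vertex that
    arrives there, which must pick different hubs; leaves and hubs are limited
    to two hubs but dispute nothing.  Thus each end of a pair rules out at most
    one of the three hubs, and a greedy choice succeeds
    ([two_obstacle_colouring]).

    With [a] the largest integer such that [2 a ^ 3 + 2 n <= m], the graph with
    [p = max (a, 1)] fits on [n] vertices because [m <= n ^ (3/2) / 4] forces
    [4 a ^ 2 <= n], and its diameter exceeds [a + 1 > (m / 2 - n) ^ (1/3)]. *)

Import Order.TTheory GRing.Theory Num.Theory.

(** * Distances *)

Section Distance.
Variables (T : finType) (G : sgraph T).
Implicit Types (x y u v : T) (p : seq T).

Lemma dist_le_card x y : dist G x y <= #|T|.
Proof. by rewrite -[X in _ <= X](size_iota 0); apply: find_size. Qed.

Lemma dist_walk x p : path (adj G) x p -> dist G x (last x p) <= size p.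
Proof.
case/shortenP=> p' p'_path p'_uniq sub_p'.
have p'_le : size p' <= size p.
  by apply: uniq_leq_size sub_p'; case/andP: p'_uniq.
apply: leq_trans p'_le; rewrite leqNgt; apply/negP=> lt_find.
have p'_lt : size p' < #|T|
  by have := max_card [in x :: p']; rewrite (card_uniqP p'_uniq).
have := before_find 0 lt_find; rewrite nth_iota //.
move/negbT/existsPn/(_ (in_tuple p'))/negP; apply.
by rewrite /is_path p'_path eqxx.
Qed.

Lemma dist_attained x y : dist G x y < #|T| ->
  exists2 p, path (adj G) x p & last x p = y /\ size p = dist G x y.
Proof.
move=> lt_card; have := lt_card; rewrite -{1}(size_iota 0 #|T|) -has_find.
move=> /(nth_find 0); rewrite -/(dist G x y) nth_iota // => /existsP[p].
by case/and3P=> ? /eqP ? _; exists p; rewrite ?size_tuple.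
Qed.

Lemma dist_refl x : dist G x x = 0.
Proof. by apply/eqP; rewrite -leqn0; apply: (@dist_walk x [::]). Qed.

(** An unreachable [u] is at the largest possible distance, so the bound extends
    to this case. *)
Lemma dist_adj x u v : adj G u v -> dist G x v <= (dist G x u).+1.
Proof.
move=> uv; have [lt_card|] := ltnP (dist G x u) #|T|; last first.
  by move=> le_card; apply: leqW; apply: leq_trans le_card; apply: dist_le_card.
have [p p_path [p_last <-]] := dist_attained lt_card.
rewrite -(size_rcons p v) -{1}(last_rcons x p v).
by apply: dist_walk; rewrite rcons_path p_path p_last.
Qed.

(** Distances are bounded from below by exhibiting a potential.  The bound on
    [phi y] covers the case where no path exists. *)
Lemma lipschitz_le_dist (phi : T -> nat) x y :
    (forall u v, adj G u v -> phi v <= (phi u).+1) -> phi y <= phi x + #|T| ->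
  phi y <= phi x + dist G x y.
Proof.
move=> phi_lip phi_card; have [lt_card|] := ltnP (dist G x y) #|T|; last first.
  by move=> le_card; apply: leq_trans phi_card _; rewrite leq_add2l.
have [p + [<- <-]] := dist_attained lt_card.
elim: p x {phi_card lt_card} => [|v p IHp] x /=; first by rewrite addn0.
by case/andP=> /phi_lip phi_xv /IHp; lia.
Qed.

Lemma dist_le_diameter x y : dist G x y <= diameter G.
Proof.
by apply: leq_trans (leq_bigmax x); apply: (@leq_bigmax _ (dist G x)).
Qed.

Lemma diameter_attained : 0 < #|T| -> exists x y, diameter G = dist G x y.
Proof.
move=> T_gt0; have [x xP] := @bigop.eq_bigmax T (fun x => \max_y dist G x y) T_gt0.
have [y yP] := @bigop.eq_bigmax T (dist G x) T_gt0.
by exists x, y; rewrite -yP -xP.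
Qed.

End Distance.

(** * The cut condition *)

Section Cuts.
Variables (T : finType) (G : sgraph T).

Definition boundary (A : {set T}) : {set {set T}} :=
  [set [set e.1; e.2] |
    e in [set e : T * T | [&& e.1 \in A, e.2 \notin A & adj G e.1 e.2]]].

Lemma path_meets_boundary (A : {set T}) x p :
    path (adj G) x p -> x \in A -> last x p \notin A ->
  exists2 e, e \in path_edges x p & e \in boundary A.
Proof.
elim: p x => [|v p IHp] x /=; first by move=> _ ->.
case/andP=> xv v_path xA last_notA.
have [vA|v_notA] := boolP (v \in A).
  have [e e_p e_A] := IHp v v_path vA last_notA.
  by exists e; rewrite // /path_edges /= inE -/(path_edges v p) e_p orbT.
exists [set x; v]; first by rewrite /path_edges /= mem_head.
by apply/imsetP; exists (x, v); rewrite // inE /= xA v_notA xv.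
Qed.

(** Pair the vertices so that as many pairs as possible are split by the cut:
    each of the resulting edge-disjoint paths has to use an edge of its own to
    cross it. *)
Lemma cut_condition (A : {set T}) :
  path_pairable G -> minn #|A| #|~: A| <= #|boundary A|.
Proof.
case=> k [k_gt0 cardT [card_ge pairable]].
have cardA := cardsC A.
set c := minn _ _.
have c_le_k : c <= k by rewrite /c; lia.
have /card_gt0P[x0 _] : 0 < #|T| by lia.
(* Listing [A] first and pairing the list with its reversal makes the first
   [c] pairs cross the cut, whichever side is the smaller one. *)
pose L := enum A ++ enum (~: A).
have L_size : size L = #|T| by rewrite size_cat -!cardE.
have L_uniq : uniq L.
  rewrite cat_uniq !enum_uniq andbT /=; apply/hasPn=> v.
  by rewrite /= !mem_enum inE.
have nthA j : j < #|A| -> nth x0 L j \in A.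
  move=> j_lt; rewrite nth_cat -cardE j_lt -mem_enum.
  by rewrite mem_nth // -cardE.
have nthC j : #|A| <= j -> j < #|T| -> nth x0 L j \notin A.
  move=> j_ge j_lt; rewrite nth_cat -cardE ltnNge j_ge /= -in_setC -mem_enum.
  by rewrite mem_nth // -cardE; lia.
pose x (j : 'I_k) := nth x0 L j.
pose y (j : 'I_k) := nth x0 L (#|T|.-1 - j).
have nth_inj i j : i < #|T| -> j < #|T| -> nth x0 L i = nth x0 L j -> i = j.
  by move=> i_lt j_lt /eqP; rewrite nth_uniq ?L_size // => /eqP.
have ord_lt (j : 'I_k) := ltn_ord j.
have x_inj : injective x.
  move=> i j /nth_inj ij; apply/val_inj/ij; move: (ord_lt i) (ord_lt j); lia.
have y_inj : injective y.
  move=> i j /nth_inj ij; apply/val_inj => /=.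
  by move: (ord_lt i) (ord_lt j); lia.
have xy_neq i j : x i <> y j.
  by move=> /nth_inj; move: (ord_lt i) (ord_lt j); lia.
have [P [P_path P_disj]] := pairable x y x_inj y_inj xy_neq.
have crossing (j : 'I_c) : exists e, let i := widen_ord c_le_k j in
    (e \in path_edges (x i) (P i)) && (e \in boundary A).
  have := P_path (widen_ord c_le_k j); set i := widen_ord _ _.
  case/and3P=> i_path /eqP i_last _; have j_lt : i < c := ltn_ord j.
  have [|| e e_p e_A] := path_meets_boundary (A := A) i_path.
  - by apply: nthA; move: j_lt; rewrite /c; lia.
  - by rewrite i_last; apply: nthC; move: j_lt; rewrite /c; lia.
  by exists e; apply/andP; split.
pose g j := xchoose (crossing j).
have g_path j : g j \in path_edges (x (widen_ord c_le_k j)) (P (widen_ord c_le_k j)).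
  by case/andP: (xchooseP (crossing j)).
have g_A j : g j \in boundary A by case/andP: (xchooseP (crossing j)).
have g_inj : injective g.
  move=> i j g_ij; apply/eqP; apply: contraTT isT => /eqP ij.
  have /P_disj/hasPn : widen_ord c_le_k i <> widen_ord c_le_k j.
    by move=> /(congr1 val)/= /val_inj.
  by move=> /(_ _ (g_path j)); rewrite /= -g_ij g_path.
rewrite -[c]card_ord -cardsT -(card_imset _ g_inj); apply: subset_leq_card.
by apply/subsetP=> e /imsetP[j _ ->].
Qed.

End Cuts.

(** * Growth of the layers *)

(** As [a_i * a_(i+1) <= ((a_i + a_(i+1)) / 2) ^ 2], two more layers add at least
    [2 sqrt S_(i-1)] to [S_(i-1)], so that [sqrt S] increases by a fixed amount
    every two steps.  Hence the induction carries two consecutive indices. *)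
Lemma square_growth (a : nat -> nat) (t : nat) :
    0 < a 0 ->
    (forall i, i < t -> \sum_(j < i.+1) a j <= a i * a i.+1) ->
  forall i, i <= t -> i.+2 ^ 2 <= 16 * \sum_(j < i.+1) a j.
Proof.
move=> a0 growth.
suff both i : (i <= t -> i.+2 ^ 2 <= 16 * \sum_(j < i.+1) a j) /\
    (i < t -> i.+3 ^ 2 <= 16 * \sum_(j < i.+2) a j).
  by move=> i; case: (both i).
elim: i => [|i [IH1 IH2]].
  split=> [_|t_gt0]; first by rewrite big_ord_recr big_ord0 /= -!mulnn; lia.
  have := growth 0 t_gt0; rewrite !big_ord_recr !big_ord0 /= => h.
  have a1 : 0 < a 1 by case: (a 1) h => //; lia.
  by rewrite -mulnn; lia.
split=> // i_lt; have := growth _ i_lt; have := IH1 (ltnW (ltnW i_lt)).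
rewrite (big_ord_recr i.+2) (big_ord_recr i.+1) /=.
set S := \sum_(j < i.+1) a j; move: (a i.+1) (a i.+2) => u v IH uv.
have AGM : 4 * (u * v) <= (u + v) ^ 2 by exact: (nat_AGM2 u v).1.
have step : i.+2 <= 2 * (u + v).
  by rewrite -leq_sqr; move: IH uv AGM; rewrite -!mulnn; lia.
by move: IH step; rewrite -!mulnn; lia.
Qed.

Lemma cube_growth (a e : nat -> nat) (t : nat) :
    0 < a 0 ->
    (forall i, i < t -> \sum_(j < i.+1) a j <= e i <= a i * a i.+1) ->
  t ^ 3 <= 48 * \sum_(i < t) e i.
Proof.
move=> a0 growth.
have [growthl growthr] : (forall i, i < t -> \sum_(j < i.+1) a j <= e i) /\
    (forall i, i < t -> \sum_(j < i.+1) a j <= a i * a i.+1).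
  by split=> i /growth/andP[] // le1 /(leq_trans le1).
have e_ge i : i < t -> i.+2 ^ 2 <= 16 * e i.
  move=> i_lt; apply: leq_trans (square_growth a0 growthr (ltnW i_lt)) _.
  by rewrite leq_mul2l growthl.
elim: t e_ge {growth growthl growthr} => // t IHt e_ge.
rewrite big_ord_recr /=; have := e_ge t (ltnSn t).
have := IHt (fun i i_lt => e_ge i (leqW i_lt)).
by move: (\sum_(_ < _) _) (e t) => S E; rewrite !expnS !expn0; nia.
Qed.

(** The growth estimate only applies until half of the weight has been passed.
    Cutting at [h = d / 2], one of the two directions of reading stays below half
    of the weight for at least half of the layers. *)
Lemma layers_bound (a e : nat -> nat) (d : nat) :
    0 < a 0 -> 0 < a d ->
    (forall i, i < d -> e i <= a i * a i.+1) ->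
    (forall i, i < d ->
      minn (\sum_(0 <= j < i.+1) a j) (\sum_(i.+1 <= j < d.+1) a j) <= e i) ->
  d ^ 3 <= 384 * \sum_(0 <= i < d) e i.
Proof.
move=> a0 ad e_le e_ge; have [->//|d_gt0] := posnP d.
pose h := d./2; have h_lt : h < d by rewrite /h; lia.
have lo i : i <= h -> \sum_(0 <= j < i.+1) a j <= \sum_(0 <= j < h.+1) a j.
  by move=> i_le; rewrite (@big_cat_nat _ _ _ i.+1 0 h.+1) //= leq_addr.
have hi i : h <= i -> i < d ->
    \sum_(i.+1 <= j < d.+1) a j <= \sum_(h.+1 <= j < d.+1) a j.
  move=> i_ge i_lt; rewrite (@big_cat_nat _ _ _ i.+1 h.+1 d.+1) //= ?leq_addl //.
  exact: ltnW.
(* Read the layers forwards in the first case, backwards in the second. *)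
have [half|/ltnW half] :=
    leqP (\sum_(0 <= j < h.+1) a j) (\sum_(h.+1 <= j < d.+1) a j).
  have hi' i : i <= h ->
      \sum_(h.+1 <= j < d.+1) a j <= \sum_(i.+1 <= j < d.+1) a j.
    move=> i_le; rewrite (@big_cat_nat _ _ _ h.+1 i.+1 d.+1) //= ?leq_addl //.
    exact: ltnW.
  have := @cube_growth a e h.+1 a0.
  case/(_ _)/Wrap=> [i i_lt|].
    have i_lt_d : i < d by apply: leq_trans h_lt.
    rewrite e_le // andbT; apply: leq_trans (e_ge _ i_lt_d).
    rewrite leq_min -(big_mkord xpredT a) leqnn /=.
    exact: leq_trans (lo _ i_lt) (leq_trans half (hi' _ i_lt)).
  move=> cube.
  have sum_le : \sum_(i < h.+1) e i <= \sum_(0 <= i < d) e i.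
    by rewrite -(big_mkord xpredT e) (@big_cat_nat _ _ _ h.+1 0 d) //= leq_addr.
  have d_le : d ^ 3 <= (2 * h.+1) ^ 3 by rewrite leq_exp2r // /h; lia.
  by move: d_le; rewrite expnMn; lia.
have lo' i : h <= i ->
    \sum_(0 <= j < h.+1) a j <= \sum_(0 <= j < i.+1) a j.
  by move=> i_ge; rewrite (@big_cat_nat _ _ _ h.+1 0 i.+1) //= leq_addr.
have rev_sum i : i < d -> \sum_(j < i.+1) a (d - j) = \sum_(d - i <= j < d.+1) a j.
  move=> i_lt; rewrite -(big_mkord xpredT (fun j => a (d - j))).
  rewrite big_nat_rev -[in RHS](add0n (d - i)) big_addn.
  have -> : d.+1 - (d - i) = i.+1 by lia.
  by apply: eq_big_nat => j j_lt; congr a; lia.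
have := @cube_growth (fun i => a (d - i)) (fun i => e (d - i.+1)) (d - h).
rewrite subn0 => /(_ ad); case/(_ _)/Wrap=> [i i_lt|].
  have i'_lt : d - i.+1 < d by lia.
  have i'S : (d - i.+1).+1 = d - i by lia.
  have := e_le _ i'_lt; rewrite i'S mulnC => ->; rewrite andbT.
  rewrite rev_sum; last by lia.
  apply: leq_trans (e_ge _ i'_lt); rewrite i'S leq_min leqnn andbT.
  rewrite -i'S; apply: leq_trans (hi _ _ _) _; try lia.
  by apply: leq_trans half _; apply: lo'; lia.
move=> cube.
have sum_le : \sum_(i < d - h) e (d - i.+1) <= \sum_(0 <= i < d) e i.
  rewrite -(big_mkord xpredT (fun i => e (d - i.+1))).
  rewrite [X in _ <= X]big_nat_rev /= (@big_cat_nat _ _ _ (d - h) 0 d) //=; last by lia.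
  by apply: leq_trans (leq_addr _ _).
have d_le : d ^ 3 <= (2 * (d - h)) ^ 3 by rewrite leq_exp2r // /h; lia.
by move: d_le; rewrite expnMn; lia.
Qed.

(** Breadth-first layers from an end of a diametral pair: no vertex lies beyond
    the last layer, so the vertices outside the ball of radius [i] are exactly
    those of the later layers. *)
Lemma diameter_cube_le (T : finType) (G : sgraph T) :
  path_pairable G -> diameter G ^ 3 <= 384 * #|edges G|.
Proof.
move=> pairable.
have T_gt0 : 0 < #|T| by case: pairable => k [k_gt0 cardT _]; lia.
have [x [y diam]] := diameter_attained G T_gt0.
set d := diameter G in diam *.
pose layer i := [set v | dist G x v == i].
pose ball i := [set v | dist G x v <= i].
pose a i := #|layer i|.
have sum_layers i j : \sum_(i <= l < j) a l = #|[set v | i <= dist G x v < j]|.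
  elim: j => [|j IHj].
    rewrite big_geq // (_ : [set v | _] = set0) ?cards0 //.
    by apply/setP=> v; rewrite !inE ltn0 andbF.
  have [ij|ij] := leqP i j; last first.
    rewrite big_geq // (_ : [set v | _] = set0) ?cards0 //.
    by apply/setP=> v; rewrite !inE; lia.
  rewrite big_nat_recr //= IHj /a -cardsUI.
  rewrite (_ : _ :&: _ = set0) ?cards0 ?addn0.
    by congr #|pred_of_set _|; apply/setP=> v; rewrite !inE; lia.
  by apply/setP=> v; rewrite !inE; lia.
have boundary_ball i e : e \in boundary G (ball i) ->
    exists u v, [/\ e = [set u; v], dist G x u = i & dist G x v = i.+1].
  case/imsetP=> -[u v]; rewrite !inE /= => /and3P[u_le v_gt uv] ->.
  by exists u, v; have := dist_adj x uv; split=> //; lia.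
have boundary_layers i : #|boundary G (ball i)| <= a i * a i.+1.
  rewrite -cardsX; apply: leq_trans (leq_imset_card (fun p => [set p.1; p.2]) _).
  apply/subset_leq_card/subsetP=> e /boundary_ball[u [v [-> u_i v_i]]].
  by apply/imsetP; exists (u, v); rewrite // !inE u_i v_i !eqxx.
have boundary_uniq i j e :
    e \in boundary G (ball i) -> e \in boundary G (ball j) -> i = j.
  move=> /boundary_ball[u [v [-> u_i v_i]]] /boundary_ball[u' [v' [uv u'_j v'_j]]].
  have : u \in [set u'; v'] by rewrite -uv set21.
  have : v \in [set u'; v'] by rewrite -uv set22.
  have : u' \in [set u; v] by rewrite uv set21.
  rewrite !inE => /orP[]/eqP e1 /orP[]/eqP e2 /orP[]/eqP e3; subst; lia.
have boundary_edges i : boundary G (ball i) \subset edges G.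
  by apply/subsetP=> e /imsetP[p]; rewrite inE => /and3P[_ _ p_adj] ->.
have sum_boundary :
    \sum_(0 <= i < d) #|boundary G (ball i)| <= #|edges G|.
  have count i : #|boundary G (ball i)| =
      \sum_(e in edges G) (e \in boundary G (ball i)).
    rewrite -[in LHS](setIidPr (boundary_edges i)) -sum1_card big_mkcond.
    rewrite [RHS]big_mkcond; apply: eq_bigr => e _; rewrite in_setI.
    by case: (e \in edges G) => //=; case: (e \in _).
  under eq_big_nat do rewrite count.
  rewrite big_mkord -[X in _ <= X]sum1_card.
  rewrite exchange_big; apply: leq_sum => e _ /=.
  case: (pickP (fun i : 'I_d => e \in boundary G (ball i))) => [i e_i|none].
    rewrite (bigD1 i) //= e_i big1 ?addn0 // => j ij; case: (boolP (_ \in _)) => // e_j.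
    by case/eqP: ij; apply/val_inj/(boundary_uniq _ _ e).
  by rewrite big1 // => i _; rewrite none.
apply: leq_trans (leq_mul (leqnn _) sum_boundary).
have a0 : 0 < a 0 by apply/card_gt0P; exists x; rewrite inE dist_refl.
have ad : 0 < a d by apply/card_gt0P; exists y; rewrite inE diam.
apply: (layers_bound a0 ad) => i i_lt //.
have -> : \sum_(0 <= j < i.+1) a j = #|ball i|.
  by rewrite sum_layers; congr #|pred_of_set _|; apply/setP=> v; rewrite !inE.
have -> : \sum_(i.+1 <= j < d.+1) a j = #|~: ball i|.
  rewrite sum_layers; congr #|pred_of_set _|; apply/setP=> v; rewrite !inE.
  by have := dist_le_diameter G x v; rewrite -/d; lia.
exact: cut_condition.
Qed.

(** * Linkages from disjoint edge sets *)

Lemma set2_eq (T : finType) (a b c d : T) :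
  [set a; b] = [set c; d] -> (a = c /\ b = d) \/ (a = d /\ b = c).
Proof.
move=> eq_ab.
have : a \in [set c; d] by rewrite -eq_ab set21.
have : b \in [set c; d] by rewrite -eq_ab set22.
have : c \in [set a; b] by rewrite eq_ab set21.
have : d \in [set a; b] by rewrite eq_ab set22.
rewrite !inE => /orP[]/eqP e1 /orP[]/eqP e2 /orP[]/eqP e3 /orP[]/eqP e4.
all: by subst; auto.
Qed.

Section Linking.
Variables (T : finType) (G : sgraph T).

Definition joined (S : {set {set T}}) : rel T :=
  connect [rel u v | [set u; v] \in S].

Lemma joined_sym (S : {set {set T}}) : connect_sym [rel u v | [set u; v] \in S].
Proof. by apply: sym_connect_sym => u v; rewrite /= setUC. Qed.

Lemma joinedS (S S' : {set {set T}}) x y :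
  S \subset S' -> joined S x y -> joined S' x y.
Proof.
move=> /subsetP sub; apply: connect_sub => u v /= uv.
by apply: connect1; apply: sub.
Qed.

Lemma path_of_joined (S : {set {set T}}) x y :
    S \subset edges G -> joined S x y ->
  exists2 p, is_path G x y p & {subset path_edges x p <= S}.
Proof.
move=> /subsetP sub /connectP[p0 /shortenP[p p_path p_uniq _] ->].
exists p; first rewrite /is_path eqxx p_uniq /= andbT.
  by apply: sub_path p_path => u v /sub.
elim: p x p_path {p_uniq} => [|v p IHp] x //= /andP[xv /IHp sub_p] e.
by rewrite /path_edges /= inE => /predU1P[->|/sub_p].
Qed.

(** It is enough to hand out disjoint sets of edges joining the terminals: simple
    paths are then found inside the sets.  This makes it possible to glue
    routes together without removing the loops that arise. *)
Lemma linkage_of_edge_sets k (x y : 'I_k -> T) (S : 'I_k -> {set {set T}}) :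
    (forall i, S i \subset edges G) -> (forall i, joined (S i) (x i) (y i)) ->
    (forall i j, i <> j -> [disjoint S i & S j]) ->
  exists P : 'I_k -> seq T,
    (forall i, is_path G (x i) (y i) (P i)) /\
    (forall i j, i <> j -> edge_disjoint (x i) (P i) (x j) (P j)).
Proof.
move=> S_edges S_joined S_disj.
have /boolp.choice[P PP] : forall i, exists p : seq T,
    is_path G (x i) (y i) p /\ {subset path_edges (x i) p <= S i}.
  by move=> i; have [p] := path_of_joined (S_edges i) (S_joined i); exists p.
have P_S i := (PP i).2.
exists P; split=> [i|i j ij]; first by have [] := PP i.
apply/hasPn=> e /P_S e_j /=.
by apply/negP=> /P_S e_i; have /disjointFr/(_ e_i) := S_disj _ _ ij; rewrite e_j.
Qed.

End Linking.

(** * Relabelling of vertices *)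

Section Relabel.
Variables (T T' : finType) (f : T -> T') (G : sgraph T) (G' : sgraph T').
Hypothesis (f_bij : bijective f).
Hypothesis (G'E : edges G' = [set f @: (e : {set T}) | e in edges G]).

Let f_inj := bij_inj f_bij.

Lemma adj_relabel u v : adj G' (f u) (f v) = adj G u v.
Proof.
have img : [set f u; f v] = f @: [set u; v] by rewrite imsetU1 imset_set1.
by rewrite /adj /= G'E img (mem_imset _ _ (imset_inj f_inj)).
Qed.

Lemma is_path_relabel x y p : is_path G' (f x) (f y) (map f p) = is_path G x y p.
Proof.
rewrite /is_path last_map (inj_eq f_inj) -map_cons (map_inj_uniq f_inj).
by rewrite path_map; congr (_ && _); apply: eq_path => u v; rewrite /= -adj_relabel.
Qed.

Lemma path_edges_relabel x p :
  path_edges (f x) (map f p) = [seq f @: e | e : {set T} <- path_edges x p].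
Proof.
rewrite /path_edges -map_cons -!map_comp; elim: p x => [|v p IHp] x //=.
by rewrite imsetU1 imset_set1 IHp.
Qed.

Lemma k_path_pairable_relabel k : k_path_pairable k G -> k_path_pairable k G'.
Proof.
have cardT : #|T| = #|T'| := bij_eq_card f_bij.
case: (f_bij) => g fK gK [k_le pairable].
split=> [|x y x_inj y_inj xy]; first by rewrite -cardT.
have g_inj := can_inj gK.
have [|||P [P_path P_disj]] := pairable (g \o x) (g \o y).
- exact: inj_comp.
- exact: inj_comp.
- by move=> i j /= /g_inj/xy.
exists (fun i => map f (P i)); split=> [i|i j ij].
  by rewrite -[x i]gK -[y i]gK is_path_relabel; apply: P_path.
rewrite /edge_disjoint -[x i]gK -[x j]gK !path_edges_relabel has_map.
have := P_disj i j ij; congr (~~ _); apply: eq_has => e /=.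
by rewrite mem_map //; apply: imset_inj.
Qed.

End Relabel.

(** * Colouring with two obstacles *)

Section Colouring.
(** Each index has two obstacles, numbered by booleans: a colour that it must
    avoid, or another index whose colour it must avoid.  An index that is its
    own obstacle stands for the absence of one. *)
Variables (I : finType) (o : bool -> I -> 'I_3 + I).
Hypothesis o_sym : forall b i j, o b i = inr j -> exists b', o b' j = inr i.

(** Greedy: when an index is coloured, its obstacles exclude at most two of the
    three colours.  By symmetry, the indices coloured before that have it as an
    obstacle are among those it avoids. *)
Lemma two_obstacle_colouring : exists chi : I -> 'I_3, forall b i,
  match o b i with
  | inl c => chi i <> c
  | inr j => i <> j -> chi i <> chi j
  end.
Proof.
suff colour (s : seq I) : exists chi : I -> 'I_3, forall b i, i \in s ->
    match o b i with
    | inl c => chi i <> c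
    | inr j => j \in s -> i <> j -> chi i <> chi j
    end.
  have [chi chiP] := colour (enum I); exists chi => b i.
  have := chiP b i; rewrite mem_enum => /(_ isT).
  by case: (o b i) => // j; rewrite mem_enum; apply.
elim: s => [|i0 s [chi chiP]]; first by exists (fun=> ord0).
have [i0_s|i0_s] := boolP (i0 \in s).
  exists chi => b i; rewrite inE => /predU1P i_s.
  have {}i_s : i \in s by case: i_s => [->|].
  have := chiP b i i_s; case: (o b i) => // j h.
  by move=> j_s; apply: h; case/predU1P: j_s => [->|].
pose avoid b := match o b i0 with inl c => c | inr j => chi j end.
have [c c_true c_false] : exists2 c, c <> avoid true & c <> avoid false.
  have : 0 < #|~: [set avoid true; avoid false]|.
    by have := cardsC [set avoid true; avoid false]; rewrite cards2 card_ord; lia.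
  case/card_gt0P=> c; rewrite !inE negb_or => /andP[/eqP ? /eqP ?].
  by exists c.
have c_avoid b : c <> avoid b by case: b.
exists (fun i => if i == i0 then c else chi i) => b i.
rewrite inE; have [->|i_i0] := eqVneq i i0 => /= [_|i_s].
  have := c_avoid b; rewrite /avoid; case: (o b i0) => // j c_j _ i0_j.
  by case: eqVneq i0_j => [->|].
have := chiP b i i_s; case o_i: (o b i) => [//|j] h.
have [j_i0 _ _|j_i0] := eqVneq j i0; last by rewrite inE (negPf j_i0); apply: h.
rewrite j_i0 in o_i; have [b' o_i0] := o_sym o_i.
by have := c_avoid b'; rewrite /avoid o_i0 => ne eq; apply: ne.
Qed.

End Colouring.

(** * The funnel graph *)

Section Funnel.
Variables r q : nat.
Let Z := 'I_r.+1.

(** [Chain l a] is in layer [l] at position [a]; [Port a k] is the port that a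
    vertex travelling with step [k] reaches from position [a] of the last layer.
    Positions and steps are residues modulo [r.+1]. *)
Inductive vertex :=
| Chain of Z & Z
| Port of Z & Z
| Hub of 'I_3
| Leaf of 'I_q.

Definition vertex_code u : Z * Z + Z * Z + 'I_3 + 'I_q :=
  match u with
  | Chain l a => inl (inl (inl (l, a)))
  | Port a k => inl (inl (inr (a, k)))
  | Hub c => inl (inr c)
  | Leaf b => inr b
  end.

Definition vertex_decode s : vertex :=
  match s with
  | inl (inl (inl (l, a))) => Chain l a
  | inl (inl (inr (a, k))) => Port a k
  | inl (inr c) => Hub c
  | inr b => Leaf b
  end.

Lemma vertex_codeK : cancel vertex_code vertex_decode. Proof. by case. Qed.

HB.instance Definition _ := Finite.copy vertex (can_type vertex_codeK).

Lemma vertex_code_bij : bijective vertex_code.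
Proof.
by exists vertex_decode; [exact: vertex_codeK | do 3?case=> //; case].
Qed.

Lemma card_vertex : #|{: vertex}| = 2 * r.+1 ^ 2 + 3 + q.
Proof.
rewrite (bij_eq_card vertex_code_bij) !card_sum !card_prod !card_ord.
by rewrite -mulnn mul2n addnn.
Qed.

(** Names for the edges.  [Rail l a k] leaves position [a] of layer [l] with step
    [k], and [Feed a k c] goes from a port to hub [c].  Working with names
    instead of unordered pairs lets disjointness of routes be decided by the
    data of the edge. *)
Inductive link :=
| Rail of Z & Z & Z
| Feed of Z & Z & 'I_3
| Spoke of 'I_q & bool
| Tie of 'I_3.

Definition link_code e : Z * Z * Z + Z * Z * 'I_3 + 'I_q * bool + 'I_3 :=
  match e with
  | Rail l a k => inl (inl (inl (l, a, k)))
  | Feed a k c => inl (inl (inr (a, k, c)))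
  | Spoke b s => inl (inr (b, s))
  | Tie c => inr c
  end.

Definition link_decode s : link :=
  match s with
  | inl (inl (inl (l, a, k))) => Rail l a k
  | inl (inl (inr (a, k, c))) => Feed a k c
  | inl (inr (b, s)) => Spoke b s
  | inr c => Tie c
  end.

Lemma link_codeK : cancel link_code link_decode. Proof. by case. Qed.

HB.instance Definition _ := Finite.copy link (can_type link_codeK).

Lemma card_link : #|{: link}| <= r.+1 ^ 3 + 3 * r.+1 ^ 2 + 2 * q + 3.
Proof.
apply: leq_trans (leq_card link_code (can_inj link_codeK)) _.
by rewrite !card_sum !card_prod !card_ord card_bool !expnS expn0; lia.
Qed.

Definition source e : vertex :=
  match e with
  | Rail l a _ => Chain l a
  | Feed a k _ => Port a k
  | Spoke b _ => Leaf b
  | Tie c => Hub c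
  end.

Definition spoke_hub (s : bool) : 'I_3 := inord s.

Definition target e : vertex :=
  match e with
  | Rail l a k => if l < r then Chain (inord l.+1) (a + k)%R else Port a k
  | Feed _ _ c => Hub c
  | Spoke _ s => Hub (spoke_hub s)
  | Tie c => Hub (c + 1)%R
  end.

Definition ends e : {set vertex} := [set source e; target e].

Lemma ord3S (c : 'I_3) : (c + 1)%R <> c /\ (c + 1 + 1)%R <> c.
Proof. by case: c => [[|[|[|]]]] //= ?; split. Qed.

Lemma ord3P (c d : 'I_3) : [\/ d = c, d = (c + 1)%R | d = (c + 1 + 1)%R].
Proof.
case: c d => [[|[|[|]]] // ?] [[|[|[|]]] // ?].
all: first [by constructor 1; apply/val_inj | by constructor 2; apply/val_inj
  | by constructor 3; apply/val_inj].
Qed.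

Lemma ends_distinct e : #|ends e| = 2.
Proof.
rewrite cards2; case: eqP => // -[]; case: e => [l a k|a k c|b s|c] //=.
  case: ltnP => // l_lt [] /(congr1 val) /=; rewrite inordK; last by [].
  by move=> /n_Sn.
by case=> /esym; have [] := ord3S c.
Qed.

(** Links are oriented so that none is the reverse of another: towards the hubs,
    and cyclically around the triangle of hubs. *)
Lemma source_neq_target e e' : source e = target e' -> target e <> source e'.
Proof.
case: e => [l a k|a k c|b s|c]; case: e' => [l' a' k'|a' k' c'|b' s'|c'] //=;
  try by do ?case: ifP.
- case: ltnP => // l'_lt [l_eq _]; case: ltnP => // l_lt [l'_eq _].
  move: (congr1 val l_eq) (congr1 val l'_eq); rewrite /= !inordK //; lia.
- by case=> -> []; have [] := ord3S c'.
Qed.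

(** Stated for variables, since injection on concrete arguments would also take
    the sums of residues apart. *)
Lemma Chain_inj l a l' a' : Chain l a = Chain l' a' -> l = l' /\ a = a'.
Proof. by case=> -> ->. Qed.

Lemma ends_inj : injective ends.
Proof.
move=> e e' /set2_eq[[]|[src tgt]]; last by case: (source_neq_target src tgt).
case: e => [l a k|a k c|b s|c]; case: e' => [l' a' k'|a' k' c'|b' s'|c'] //=.
- move=> [<- <-]; case: ifP => _; last by case=> ->.
  by case/Chain_inj=> _ /addrI->.
- by move=> [-> ->] [->].
- move=> [->] [] /(congr1 val); rewrite /= !inordK; try by case: s s' => [] [].
- by move=> [->].
Qed.

Fact funnel_subproof : [forall e in [set ends e | e : link], #|e| == 2].
Proof. by apply/forall_inP=> _ /imsetP[e _ ->]; rewrite ends_distinct. Qed.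

Definition funnel : sgraph vertex := SGraph funnel_subproof.

Lemma card_funnel : #|edges funnel| <= r.+1 ^ 3 + 3 * r.+1 ^ 2 + 2 * q + 3.
Proof. exact: leq_trans (leq_imset_card _ _) card_link. Qed.

Lemma adj_funnel u v : adj funnel u v ->
  exists e, (u = source e /\ v = target e) \/ (u = target e /\ v = source e).
Proof. by case/imsetP=> e _ /set2_eq; exists e. Qed.

Definition height u : nat :=
  match u with
  | Chain l _ => l
  | Port _ _ => r.+1
  | Hub _ => r.+2
  | Leaf _ => r.+3
  end.

Lemma height_adj u v : adj funnel u v -> height v <= (height u).+1.
Proof.
case/adj_funnel=> e; case: e => [l a k|a k c|b s|c] [] [-> ->] /=.
- by case: ltnP => /= l_r; [rewrite inordK | have := leq_ord l; lia].
- by case: ltnP => /= l_r; [rewrite inordK //; lia | have := leq_ord l; lia].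
all: lia.
Qed.

(** The position, at layer [l], of the traveller that starts at [Chain i j]. *)
Definition at_layer (i j l : Z) : Z := (j + i *+ (l - i))%R.

(** A chain vertex and the port where it arrives are mates: both need an edge
    from this port to a hub. *)
Definition mate u : vertex :=
  match u with
  | Chain i j => Port (at_layer i j ord_max) i
  | Port a k => Chain k (a - k *+ (r - k))%R
  | Hub _ | Leaf _ => u
  end.

Lemma mateK : involutive mate.
Proof. by case=> [i j|a k|c|b] //=; rewrite /at_layer ?addrK ?subrK. Qed.

(** The hub that the route of a vertex cannot have as its end.  Hub [c] is only
    allowed the edge towards hub [c + 1], since the edge towards hub [c + 2] is
    at the disposal of the latter. *)
Definition forbidden u : option 'I_3 :=
  match u with
  | Chain _ _ | Port _ _ => None
  | Hub c => Some (c + 1 + 1)%R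
  | Leaf _ => Some ord_max
  end.

(** The links on the route from [u] to hub [chi]. *)
Definition uses u (chi : 'I_3) e : bool :=
  match u, e with
  | Chain i j, Rail l a k => [&& k == i, i <= l & a == at_layer i j l]
  | Chain i j, Feed a k c => [&& k == i, a == at_layer i j ord_max & c == chi]
  | Port a k, Feed a' k' c => [&& k' == k, a' == a & c == chi]
  | Leaf b, Spoke b' s => (b' == b) && (spoke_hub s == chi)
  | Hub c, Tie c' => (c' == c) && (chi == c + 1)%R
  | _, _ => false
  end.

Definition route u chi : {set {set vertex}} := [set ends e | e in uses u chi].

Lemma route_funnel u chi : route u chi \subset edges funnel.
Proof. by apply/subsetP=> _ /imsetP[e _ ->]; apply: imset_f. Qed.

Lemma joined_link u chi e :
  uses u chi e -> joined (route u chi) (source e) (target e).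
Proof. by move=> e_u; apply: connect1; apply: imset_f. Qed.

Lemma joined_chain chi (i j : Z) l : i <= l -> l <= r ->
  joined (route (Chain i j) chi)
    (Chain i j) (Chain (inord l) (at_layer i j (inord l))).
Proof.
elim: l => [|l IHl] i_le l_le.
  rewrite (_ : inord 0 = i); last by apply/val_inj; rewrite /= inordK //; lia.
  by rewrite /at_layer subnn mulr0n addr0; apply: connect0.
have [i_l|l_i] := leqP i l; last first.
  rewrite (_ : inord l.+1 = i); last by apply/val_inj; rewrite /= inordK //; lia.
  by rewrite /at_layer subnn mulr0n addr0; apply: connect0.
apply: connect_trans (IHl i_l (ltnW l_le)) _.
have := @joined_link (Chain i j) chi (Rail (inord l) (at_layer i j (inord l)) i).
rewrite /uses /source /target !eqxx !inordK ?i_l ?l_le //; last by apply: ltnW.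
move=> /(_ isT); congr (joined _ _ (Chain _ _)).
by rewrite /at_layer !inordK ?subSn ?mulrSr ?addrA //; apply: ltnW.
Qed.

Lemma joined_hub u chi :
  Some chi <> forbidden u -> joined (route u chi) u (Hub chi).
Proof.
case: u => [i j|a k|c|b] /= chi_ok.
- have maxE : inord r = ord_max :> Z by apply/val_inj; rewrite /= inordK.
  have := joined_chain chi j (leq_ord i) (leqnn r); rewrite maxE => toMax.
  apply: connect_trans toMax _.
  have := @joined_link (Chain i j) chi (Rail ord_max (at_layer i j ord_max) i).
  rewrite /uses /source /target !eqxx leq_ord ltnn => /(_ isT) toPort.
  apply: connect_trans toPort _.
  apply: (@joined_link (Chain i j) chi (Feed (at_layer i j ord_max) i chi)).
  by rewrite /= !eqxx.
- by apply: (@joined_link (Port a k) chi (Feed a k chi)); rewrite /= !eqxx.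
- case: (ord3P c chi) chi_ok => -> chi_ok; [exact: connect0 | | by []].
  by apply: (@joined_link (Hub c) (c + 1)%R (Tie c)); rewrite /= !eqxx.
- have [s sE] : exists s, spoke_hub s = chi.
    exists (chi == 1%R); apply/val_inj; rewrite /= inordK; last by case: eqP.
    case: chi chi_ok => [[|[|[|]]]] //= ? ok.
    by case: ok; congr Some; apply/val_inj.
  rewrite -sE; apply: (@joined_link (Leaf b) (spoke_hub s) (Spoke b s)).
  by rewrite /= !eqxx.
Qed.

(** A rail determines its step [k], which is the starting layer of the traveller,
    and then its starting position by cancellation.  Only the feeds of a port
    are shared, between the port and its mate. *)
Lemma uses_clash u u' chi chi' e : uses u chi e -> uses u' chi' e ->
  u = u' \/ (u' = mate u /\ chi = chi').
Proof.
case: u => [i j|a k|c|b]; case: u' => [i' j'|a' k'|c'|b'];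
  case: e => [l x y|x y z|s t|t] //=.
- case/and3P=> /eqP-> _ /eqP-> /and3P[/eqP-> _ /eqP/addIr->]; by left.
- case/and3P=> /eqP-> /eqP-> _ /and3P[/eqP-> /eqP/addIr-> _]; by left.
- case/and3P=> /eqP-> /eqP-> /eqP-> /and3P[/eqP-> /eqP-> /eqP->]; by right.
- case/and3P=> /eqP-> /eqP-> /eqP-> /and3P[/eqP-> /eqP-> /eqP->]; right.
  by rewrite /at_layer addrK.
- case/and3P=> /eqP-> /eqP-> _ /and3P[/eqP-> /eqP-> _]; by left.
- by case/andP=> /eqP-> _ /andP[/eqP-> _]; left.
- by case/andP=> /eqP-> _ /andP[/eqP-> _]; left.
Qed.

Lemma forbidden_mate u : forbidden u = None -> forbidden (mate u) = None.
Proof. by case: u. Qed.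

(** The obstacles of a pair come from its two ends: the hub forbidden to an end,
    or else the pair containing its mate.  An end never has both, as the
    vertices with a forbidden hub are their own mates. *)
Lemma hub_assignment k (x y : 'I_k -> vertex) :
    injective x -> injective y -> (forall i j, x i <> y j) ->
  let t (b : bool) i := if b then x i else y i in
  exists chi : 'I_k -> 'I_3,
    (forall b i, Some (chi i) <> forbidden (t b i)) /\
    (forall b i b' j, i <> j -> t b' j = mate (t b i) -> chi i <> chi j).
Proof.
move=> x_inj y_inj xy t.
have t_inj b i b' j : t b i = t b' j -> i = j.
  by case: b b' => [] [] /=; [move/x_inj|move/xy|move/esym/xy|move/y_inj].
pose o b i : 'I_3 + 'I_k :=
  if forbidden (t b i) is Some c then inl c else
  if [pick j | (x j == mate (t b i)) || (y j == mate (t b i))] is Some j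
  then inr j else inr i.
have oE b i b' j : forbidden (t b i) = None -> t b' j = mate (t b i) ->
    o b i = inr j.
  rewrite /o => -> t_j; case: pickP => [j' j'P|/(_ j)]; last first.
    by rewrite -t_j; case: (b') => /=; rewrite eqxx ?orbT.
  congr inr; case/orP: j'P => /eqP j'P.
    by apply: (t_inj true j' b'); rewrite t_j.
  by apply: (t_inj false j' b'); rewrite t_j.
have o_sym b i j : o b i = inr j -> exists b', o b' j = inr i.
  rewrite {1}/o; case t_free: (forbidden (t b i)) => [//|].
  have free_j b' : t b' j = mate (t b i) -> o b' j = inr i.
    move=> t_j; apply: (oE _ _ b); first by rewrite t_j forbidden_mate.
    by rewrite t_j mateK.
  case: pickP => [j' /orP[]/eqP t_j' [?]|no_j [ij]]; subst.
  - by exists true; apply: free_j.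
  - by exists false; apply: free_j.
  exists b; rewrite /o t_free; case: pickP => // j'; by rewrite no_j.
have [chi chiP] := two_obstacle_colouring o_sym.
exists chi; split=> [b i|b i b' j ij t_j].
  have := chiP b i; rewrite /o; case: (forbidden _) => [c|] // ne [eq].
  exact: ne.
have free : forbidden (t b i) = None.
  case t_forb: (forbidden (t b i)) => [c|] //.
  case: ij; apply: (t_inj b i b' j); rewrite t_j.
  by case: (t b i) t_forb.
by have := chiP b i; rewrite (oE _ _ _ _ free t_j); apply.
Qed.

Lemma funnel_pairable k : 2 * k <= #|{: vertex}| -> k_path_pairable k funnel.
Proof.
move=> k_le; split=> // x y x_inj y_inj xy.
have [chi [chi_ok chi_mate]] := hub_assignment x_inj y_inj xy.
apply: (linkage_of_edge_sets
  (S := fun i => route (x i) (chi i) :|: route (y i) (chi i))).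
- by move=> i; rewrite subUset !route_funnel.
- move=> i; apply: (@connect_trans _ _ (Hub (chi i))).
    by apply: joinedS (joined_hub (chi_ok true i)); apply: subsetUl.
  rewrite joined_sym.
  by apply: joinedS (joined_hub (chi_ok false i)); apply: subsetUr.
move=> i j ij.
have disj b b' : [disjoint route (if b then x i else y i) (chi i)
                  & route (if b' then x j else y j) (chi j)].
  rewrite -setI_eq0; apply/eqP/setP=> e; rewrite !inE; apply/negP.
  case/andP=> /imsetP[s s_i ->] /imsetP[s' s'_j /ends_inj ss']; subst s'.
  have [same|[/esym mates same]] := uses_clash s_i s'_j.
    case: b b' same {s_i s'_j} => [] [].
    - by move/x_inj.
    - by move/xy.
    - by move/esym/xy.
    - by move/y_inj.
  by apply: (chi_mate b i b' j ij) same; rewrite mates.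
rewrite -setI_eq0 setIUl !setIUr !setU_eq0 !setI_eq0.
by rewrite (disj true true) (disj true false) (disj false true) (disj false false).
Qed.

End Funnel.

(** * The extremal diameter *)

Lemma graph_of_large_diameter (r q n : nat) :
    0 < q -> n = 2 * r.+1 ^ 2 + 3 + q ->
  exists G : sgraph 'I_n, [/\ path_pairable G,
    #|edges G| <= r.+1 ^ 3 + 3 * r.+1 ^ 2 + 2 * q + 3 & r.+3 <= diameter G].
Proof.
move=> q_gt0 nE.
have card_n : #|{: vertex r q}| = n by rewrite card_vertex nE.
pose f (u : vertex r q) : 'I_n := cast_ord card_n (enum_rank u).
pose g (i : 'I_n) : vertex r q := enum_val (cast_ord (esym card_n) i).
have fK : cancel f g by move=> u; rewrite /f /g cast_ordK enum_rankK.
have gK : cancel g f by move=> i; rewrite /f /g enum_valK cast_ordKV.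
have f_bij : bijective f by exists g.
pose E := [set f @: (e : {set vertex r q}) | e in edges (funnel r q)].
have E_pairs : [forall e in E, #|e| == 2].
  apply/forall_inP=> _ /imsetP[e /imsetP[l _ ->] ->].
  by rewrite card_imset ?ends_distinct //; apply: can_inj fK.
pose G := SGraph E_pairs; exists G.
have GE : edges G = [set f @: (e : {set vertex r q}) | e in edges (funnel r q)].
  by [].
split.
- exists n./2; rewrite card_ord; split; try lia.
  by apply: (k_path_pairable_relabel f_bij GE); apply: funnel_pairable; lia.
- exact: leq_trans (leq_imset_card _ _) (card_funnel r q).
pose low : 'I_n := f (Chain _ ord0 ord0).
pose high : 'I_n := f (Leaf _ (Ordinal q_gt0)).
apply: leq_trans (dist_le_diameter G low high).
have := @lipschitz_le_dist _ G (fun i => height (g i)) low high.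
rewrite !fK card_ord /= !add0n; apply; last by rewrite nE -mulnn; nia.
move=> u v; rewrite -{1}(gK u) -{1}(gK v) (adj_relabel f_bij GE).
exact: height_adj.
Qed.

(** The bounds on [m] force [n >= 64], and together with the one on [a] they give
    [4 a ^ 2 <= n], which leaves room for the [2 p ^ 2] chain vertices and ports,
    the hubs and at least one leaf.  For [a = 0] the funnel with a single chain
    vertex is used. *)
Lemma max_diameter_ge (n m a : nat) :
    0 < n -> 2 * n <= m -> 16 * m ^ 2 <= n ^ 3 -> 2 * a ^ 3 + 2 * n <= m ->
  a.+2 <= max_diameter n (at_most_edges m).
Proof.
move=> n_gt0 n_le m_le a_le.
have n_ge : 64 <= n.
  have : 16 * (2 * n) ^ 2 <= n ^ 3.
    by apply: leq_trans m_le; rewrite leq_mul2l leq_sqr n_le.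
  by rewrite !expnS expn0; nia.
have a2_le : 4 * a ^ 2 <= n.
  rewrite -(@leq_exp2r _ _ 3) //; apply: leq_trans m_le.
  have -> : (4 * a ^ 2) ^ 3 = 16 * (2 * a ^ 3) ^ 2.
    by rewrite !expnS !expn0; lia.
  by rewrite leq_mul2l leq_sqr; lia.
pose r := a.-1; pose q := n - (2 * r.+1 ^ 2 + 3).
have r2_le : 4 * r.+1 ^ 2 <= n by rewrite /r; case: (a) a2_le => //=; lia.
have [|| G [pairable card_G diam_G]] := @graph_of_large_diameter r q n.
- by rewrite /q; lia.
- by rewrite /q; lia.
apply: leq_trans (_ : diameter G <= _); first by rewrite /r in diam_G; lia.
rewrite /max_diameter.
apply: (@leq_bigmax_cond _ _ (fun G : sgraph 'I_n => diameter G) G).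
apply/andP; split; last exact/asboolP.
rewrite /at_most_edges; apply: leq_trans card_G _.
have r3_le : r.+1 ^ 3 <= 2 * a ^ 3 + r.+1 ^ 2.
  by rewrite /r; case: (a) => //= b; lia.
by rewrite /q; lia.
Qed.

Lemma max_diameter_cube_le (n m : nat) :
  max_diameter n (at_most_edges m) ^ 3 <= 384 * m.
Proof.
rewrite /max_diameter.
apply: (@big_ind _ (fun d => d ^ 3 <= 384 * m)) => //.
  by move=> d d' d_le d'_le; rewrite /maxn; case: ifP.
move=> G /andP[G_edges /asboolP/diameter_cube_le G_diam].
by apply: leq_trans G_diam _; rewrite leq_mul2l.
Qed.

Lemma cube_sandwich (n m : nat) : 2 * n <= m ->
  exists2 a, 2 * a ^ 3 + 2 * n <= m & m < 2 * a.+1 ^ 3 + 2 * n.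
Proof.
move=> n_le; have large : exists b, m < 2 * b ^ 3 + 2 * n.
  by exists m.+1; rewrite !expnS expn0; nia.
case: (ex_minnP large) => -[|a] a_gt a_min; first by lia.
exists a => //; rewrite leqNgt; apply/negP=> /a_min; lia.
Qed.

Local Open Scope ring_scope.

Lemma cube_rootK (R : realType) (x : R) : 0 <= x -> (x ^+ 3) `^ (1 / 3) = x.
Proof.
move=> x0; rewrite -(powR_mulrn 3 x0) -powRrM (_ : 3%:R * (1 / 3) = 1).
  exact: powRr1.
by field.
Qed.

Theorem theorem1 (R : realType) (n m : nat)
    (hn : (0 < n)%N) (hm : (0 < m)%N)
    (hnm : (2 * n <= m)%N)
    (hmn : (m%:R : R) <= 1 / 4 * n%:R `^ (3 / 2)) :
  (1 / 2 * m%:R - n%:R : R) `^ (1 / 3)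
    <= (max_diameter n (at_most_edges m))%:R
  /\ (max_diameter n (at_most_edges m))%:R <= 16 * (m%:R : R) `^ (1 / 3).
Proof.
have third_ge0 : 0 <= 1 / 3 :> R by rewrite divr_ge0.
split.
  have m_le : (16 * m ^ 2 <= n ^ 3)%N.
    have w2 : (n%:R `^ (3 / 2)) ^+ 2 = n%:R ^+ 3 :> R.
      rewrite -!powR_mulrn ?powR_ge0 // -powRrM; congr (_ `^ _).
      by field.
    rewrite -(ler_nat R) natrM !natrX -w2.
    have := powR_ge0 (n%:R : R) (3 / 2); have : 0 <= m%:R :> R by [].
    move: hmn; set w := _ `^ _; nra.
  have [a a_le a_gt] := cube_sandwich hnm.
  have diam_ge := max_diameter_ge hn hnm m_le a_le.
  apply: (@le_trans _ _ a.+1%:R); last by rewrite ler_nat ltnW.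
  rewrite -(cube_rootK (ler0n R a.+1)); apply: ge0_ler_powR => //.
  - by move: hnm; rewrite nnegrE -(ler_nat R) natrM; lra.
  - by rewrite nnegrE exprn_ge0.
  have : m%:R <= (2 * a.+1 ^ 3 + 2 * n)%:R :> R by rewrite ler_nat ltnW.
  by rewrite natrD (natrM _ 2 n) (natrM _ 2 (_ ^ _)) natrX; lra.
set D := max_diameter _ _.
have D_le : D%:R ^+ 3 <= 16 ^+ 3 * m%:R :> R.
  have : (D ^ 3)%:R <= (384 * m)%:R :> R.
    by rewrite ler_nat max_diameter_cube_le.
  by rewrite natrX natrM; have : 0 <= m%:R :> R by []; lra.
rewrite -[D%:R](cube_rootK (ler0n R D)).
have <- : (16 ^+ 3 * m%:R) `^ (1 / 3) = 16 * m%:R `^ (1 / 3) :> R.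
  by rewrite powRM ?exprn_ge0 // cube_rootK.
apply: ge0_ler_powR => //; rewrite nnegrE; first exact: exprn_ge0.
by apply: mulr_ge0 => //; apply: exprn_ge0.
Qed.
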